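(* Let $w_1\ge\dots\ge w_n\ge 0$ be integers, not all zero, and let $[q;w]=[q;w_1,\dots,w_n]$ be a representation of a weighted majority game with player set $N=\{1,\dots,n\}$. Put $\bar q=q/\sum_{l=1}^n w_l$ and $\bar w=w/\sum_{l=1}^n w_l$. Let $t$ (with $1\le t\le n$) be the number of numerically distinct values among $w_1,\dots,w_n$, and let $m^\circ=\min_{i\in\{1,\dots,n\}} m_{w_i}$, where $m_\omega$ denotes the number of players $j\in\{1,\dots,n\}$ with $w_j=\omega$. If $$\min\{\bar q,1-\bar q\}\cdot m^\circ>2t\,w_1^2,$$ then the nucleolus $x^*$ of this weighted majority game satisfies $x^*=\bar w$.
   Context: The weighted majority game represented by $[q;w_1,\dots,w_n]$ (quota $q$, a non-negative real number, and weights $w_i\ge 0$) is the function $v$ on subsets $S$ of $N=\{1,\dots,n\}$ given by $v(S)=1$ if $\sum_{i\in S}w_i\ge q$ and $v(S)=0$ otherwise. For $x\in\mathbb{R}^n$ write $x(S)=\sum_{i\in S}x_i$. An imputation is a vector $x\in\mathbb{R}^n$ with $x_i\ge v(\{i\})$ for all $i\in N$ and $x(N)=v(N)$. The excess of $S\subseteq N$ at an imputation $x$ is $e(S,x)=v(S)-x(S)$. Let $E(x)\in\mathbb{R}^{2^n}$ be the vector of the excesses of all $2^n$ coalitions $S\subseteq N$ at $x$, arranged in weakly decreasing order. An imputation $x$ is lexicographically less than an imputation $y$ if $E_k(x)<E_k(y)$ for the smallest index $k$ with $E_k(x)\ne E_k(y)$. The nucleolus of $(N,v)$ is the unique lexicographically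 minimal imputation. *)

(* Defs.v *)
From mathcomp Require Import all_boot all_order all_algebra.
From mathcomp Require Import reals.

Set Implicit Arguments.
Unset Strict Implicit.
Unset Printing Implicit Defensive.

Import Order.TTheory GRing.Theory Num.Theory.
Local Open Scope ring_scope.

(* The player set N is 'I_n (players numbered from 0), and a vector x in R^n
   is a row vector. *)

Section Games.

Variables (R : realType) (n : nat).

Definition game := {set 'I_n} -> R.

Definition weighted_majority_game (q : R) (w : 'rV[R]_n) : game :=
  fun A => if q <= \sum_(i in A) w 0 i then 1 else 0.

Implicit Types (v : game) (x y : 'rV[R]_n) (A : {set 'I_n}).

Definition payoff x A : R := \sum_(i in A) x 0 i.

Definition imputation v x : Prop :=
  (forall i, v [set i] <= x 0 i) /\ payoff x [set: 'I_n] = v [set: 'I_n].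

Definition excess v A x : R := v A - payoff x A.

(* The empty and the grand coalition are included, so there are 2 ^ n entries,
   indexed from 0. *)
Definition excess_vector v x : seq R :=
  sort >=%R [seq excess v A x | A : {set 'I_n}].

Definition lex_less v x y : Prop :=
  exists k : nat,
    [/\ (k < 2 ^ n)%N,
        forall j : nat, (j < k)%N -> (excess_vector v x)`_j = (excess_vector v y)`_j
      & (excess_vector v x)`_k < (excess_vector v y)`_k].

Definition lex_minimal v x : Prop :=
  imputation v x /\ (forall y, imputation v y -> ~ lex_less v y x).

(* The predicate includes uniqueness: [unique P x] unfolds to
   [P x /\ forall x', P x' -> x = x']. *)
Definition is_nucleolus v x : Prop := unique (lex_minimal v) x.

End Games.

Section IntegerWeights.

Variable n : nat.
Implicit Type w : 'I_n.+1 -> nat.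

Definition total_weight w : nat := (\sum_i w i)%N.

Definition num_types w : nat := size (undup [seq w i | i : 'I_n.+1]).

Definition multiplicity w (omega : nat) : nat := #|[set j | w j == omega]|.

(* [minn] has no neutral element; starting from the value at the first player
   leaves the minimum unchanged. *)
Definition min_multiplicity w : nat :=
  \big[minn/multiplicity w (w ord0)]_(i < n.+1) multiplicity w (w i).

End IntegerWeights.

Definition weight_vector (R : realType) (n : nat) (w : 'I_n -> nat) : 'rV[R]_n :=
  \row_i (w i)%:R.

(* Main.v *)
Require Import Defs.
From mathcomp Require Import all_boot all_order all_algebra.
From mathcomp Require Import reals ring lra.

Import Order.TTheory GRing.Theory Num.Theory.
Local Open Scope ring_scope.

(** Write wbar for the normalized weights, W for the total weight, and let Q be
the least total weight of a winning coalition.  At wbar a winning coalition of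
weight s has excess 1 - s / W and a losing one has excess at most 0, so the
maximal excess at wbar is 1 - Q / W, attained exactly on the winning coalitions
of weight Q.  If every imputation y other than wbar has a strictly larger
maximal excess, then the lexicographic comparison is settled by the first entry
of the excess vectors, and wbar is the nucleolus ([is_nucleolus_of_max_excess]).

Let d = y - wbar, so that d is nonzero and its entries add up to 0.  A coalition
T of weight exactly Q with d(T) < 0 has a larger excess at y than at wbar, and
[improving_coalition] produces one.  For that, regard a coalition as a profile:
the number s_k of its members of each type k, out of m_k players of weight
omega_k.  The proportional profile theta * m_k with theta = Q / W has weight Q
but need not be integral.  The hypothesis on q and the multiplicities says that
it is so far from the bounds 0 and m_k that it can be rounded within the box.

The rounding starts from an integral profile of weight Q (that of a minimal
winning coalition).  Changing the number of players of a type k by multiples of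
the largest weight M = omega_a can be offset by an integral number of players of
weight M; hence each s_k with k <> a can be moved to within M of theta * m_k, on
whichever side is preferred ([signed_profile]).  With delta_k the average of d
over type k, the sum of s_k * delta_k over the types equals, because of
sum m_k * delta_k = 0 and of the constraint on the weight, the sum of
(s_k - theta * m_k) * gamma_k, where gamma = delta - rho * omega vanishes at a.
The sides can be chosen so as to make every term nonpositive, and negative where
gamma_k <> 0.

Finally the players of each type are chosen so that d is at most its average
([low_subset]).  If gamma is not zero, then d(T) < 0.  If gamma = 0, then delta is
proportional to omega, and the zero total forces delta = 0; then d is not
constant on some type, and choosing s_k of its players, with 0 < s_k < m_k, gives
strictly less than average. *)

(** * Comparing imputations by their maximal excess *)

Lemma excess_le_head (R : realType) (n : nat) (v : game R n) (x : 'rV[R]_n)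
    (A : {set 'I_n}) :
  excess v A x <= (excess_vector v x)`_0.
Proof.
have geT : total (>=%R : rel R) by move=> a b; exact: le_total.
have ge_trans : transitive (>=%R : rel R) by move=> b a c /= ba cb; exact: le_trans cb ba.
have mA : excess v A x \in excess_vector v x.
  by rewrite mem_sort; apply: image_f.
have := sort_sorted geT [seq excess v B x | B : {set 'I_n}].
rewrite -/(excess_vector v x); case: (excess_vector v x) mA => // e E.
rewrite inE => /predU1P[-> _ //|mA /=]; rewrite path_sortedE // => /andP[/allP].
by move/(_ _ mA).
Qed.

Lemma head_excess (R : realType) (n : nat) (v : game R n) (x : 'rV[R]_n) :
  exists A : {set 'I_n}, (excess_vector v x)`_0 = excess v A x.
Proof.
have : (excess_vector v x)`_0 \in excess_vector v x.
  apply: mem_nth; rewrite size_sort size_image.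
  by apply/card_gt0P; exists set0.
by rewrite mem_sort => /mapP[A _ ->]; exists A.
Qed.

(** The first entry of the excess vector is the maximal excess, so the hypothesis
decides every lexicographic comparison with x at index 0; this gives both
minimality and uniqueness. *)
Lemma is_nucleolus_of_max_excess (R : realType) (n : nat) (v : game R n)
    (x : 'rV[R]_n) :
  imputation v x ->
  (forall y, imputation v y -> y != x ->
    exists B, forall A, excess v A x < excess v B y) ->
  is_nucleolus v x.
Proof.
move=> ix best.
have head_lt y : imputation v y -> y != x ->
    (excess_vector v x)`_0 < (excess_vector v y)`_0.
  move=> iy /(best y iy)[B ltB]; have [A ->] := head_excess _ _ v x.
  exact: lt_le_trans (ltB A) (excess_le_head _ _ _ _ _).
split; first split => // y iy [k [_ eqE ltE]].
  have [yx|/(head_lt _ iy)] := eqVneq y x; first by rewrite yx ltxx in ltE.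
  case: k eqE ltE => [_ lt0|k /(_ 0%N isT) ->]; last by rewrite ltxx.
  by move/(lt_trans lt0); rewrite ltxx.
move=> y [iy miny]; apply/eqP; rewrite eq_sym; apply/negPn/negP => neq_yx.
apply: (miny x ix); exists 0%N; split=> //; last exact: head_lt.
by rewrite expn_gt0.
Qed.

(** * Choosing players within a type *)

(** A subset T of size s minimizing the sum of d works: exchanging one element
shows that d is at most as large on T as on the rest of C.  Summing d j - d i
over all i in T and j in C outside T gives exactly the difference of the two sides
of the inequality; if this vanishes and neither T nor its complement in C is
empty, all these values of d agree. *)
Lemma low_subset (R : realDomainType) (I : finType) (C : {set I}) (d : I -> R)
    (s : nat) :
  (s <= #|C|)%N ->
  exists T : {set I}, [/\ T \subset C, #|T| = s,
    #|C|%:R * (\sum_(i in T) d i) <= s%:R * \sum_(i in C) d i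
    & (0 < s < #|C|)%N ->
      #|C|%:R * (\sum_(i in T) d i) = s%:R * \sum_(i in C) d i ->
      {in C &, forall i j, d i = d j}].
Proof.
move=> le_sC.
pose P (T : {set I}) := (T \subset C) && (#|T| == s).
have [T0 PT0] : exists T0, P T0.
  have /card_gt0P[T0] : (0 < #|[set T : {set I} | T \subset C & #|T| == s]|)%N.
    by rewrite cards_draws bin_gt0.
  by rewrite inE; exists T0.
case: (Order.TotalTheory.arg_minP (fun T : {set I} => \sum_(i in T) d i) PT0).
move=> T /andP[sTC /eqP cT] minT.
have le_d i j : i \in T -> j \in C :\: T -> d i <= d j.
  move=> iT; rewrite inE => /andP[jT jC].
  (* T with i replaced by j competes with T in the minimization. *)
  have jTi : j \notin T :\ i by rewrite inE negb_and jT orbT.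
  have PT' : P (j |: (T :\ i)).
    rewrite /P subUset sub1set jC (subset_trans (subD1set T i)) //=.
    by rewrite cardsU1 jTi -cT (cardsD1 i T) iT.
  have := minT _ PT'; rewrite (big_setD1 i iT) /= big_setU1 //=.
  by rewrite lerD2r.
have gapE : s%:R * (\sum_(i in C) d i) - #|C|%:R * (\sum_(i in T) d i)
    = \sum_(i in T) \sum_(j in C :\: T) (d j - d i).
  have sumT i : \sum_(j in C :\: T) (d j - d i)
      = \sum_(j in C :\: T) d j - #|C :\: T|%:R * d i.
    by rewrite sumrB sumr_const mulr_natl.
  rewrite (eq_bigr _ (fun i _ => sumT i)) sumrB sumr_const cT -mulr_sumr.
  rewrite (big_setID T) /= (setIidPr sTC) cardsD (setIidPr sTC) cT.
  by rewrite natrB // -mulr_natl; ring.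
have gap_ge0 i : i \in T -> 0 <= \sum_(j in C :\: T) (d j - d i).
  by move=> iT; apply: sumr_ge0 => j jCT; rewrite subr_ge0 le_d.
exists T; split=> //; first by rewrite -subr_ge0 gapE sumr_ge0.
case/andP=> s_gt0 s_lt eqT.
have eq_d i j : i \in T -> j \in C :\: T -> d j = d i.
  move=> iT jCT; apply/eqP; rewrite -subr_eq0; apply/eqP.
  have /eqP := gapE; rewrite eqT subrr eq_sym psumr_eq0 //.
  move=> /allP/(_ i (mem_index_enum _)); rewrite iT /=.
  rewrite psumr_eq0 => [|k kCT]; last by rewrite subr_ge0 le_d.
  by move=> /allP/(_ j (mem_index_enum _)); rewrite jCT /= => /eqP.
have [i0 i0T] : exists i0, i0 \in T by apply/card_gt0P; rewrite cT.
have [j0 j0CT] : exists j0, j0 \in C :\: T.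
  by apply/card_gt0P; rewrite cardsD (setIidPr sTC) cT subn_gt0.
suff eq0 i : i \in C -> d i = d i0 by move=> i j /eq0-> /eq0->.
move=> iC; case: (boolP (i \in T)) => iT; last by apply: eq_d; rewrite // inE iT.
by rewrite -(eq_d i j0) // (eq_d i0 j0).
Qed.

(** * Rounding the proportional profile *)

(** Consecutive elements of a + M Z are M apart, so one of them lies in [-M, 0[
and one in ]0, M]; the sign of g decides which one to take. *)
Lemma signed_rounding (R : archiRealFieldType) (M : nat) (a g : R) :
  (0 < M)%N ->
  exists z : int, [/\ `|a + M%:R * z%:~R| <= M%:R, (a + M%:R * z%:~R) * g <= 0
    & g != 0 -> (a + M%:R * z%:~R) * g < 0].
Proof.
move=> M_gt0; have MR_gt0 : 0 < M%:R :> R by rewrite ltr0n.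
have down (b : R) : exists z : int, - M%:R <= b + M%:R * z%:~R < 0.
  exists (- Num.floor (b / M%:R) - 1).
  have /andP[] := Num.Theory.floor_itv (b / M%:R).
  rewrite ler_pdivlMr // ltr_pdivrMr // rmorphB rmorphN rmorphD /= => ? ?.
  by apply/andP; split; lra.
case: (leP 0 g) => g0.
  have [z /andP[lo hi]] := down a; exists z; split.
  - by rewrite ltr0_norm // lerNl.
  - by apply: mulr_le0_ge0 => //; exact: ltW.
  - by move=> gn0; rewrite nmulr_rlt0 // lt0r gn0.
have [z /andP[lo hi]] := down (- a); exists (- z).
have E : a + M%:R * (- z)%:~R = - (- a + M%:R * z%:~R) by rewrite rmorphN /=; ring.
have lt0 : (a + M%:R * (- z)%:~R) * g < 0.
  by rewrite E mulNr oppr_lt0 nmulr_rgt0.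
by split=> //; [rewrite E normrN ltr0_norm // lerNl | exact: ltW].
Qed.

(** Each coordinate k <> a of the integral vector s0 is moved by a multiple of
omega a, towards c but on the side opposite to the sign of g k; coordinate a
then compensates for the change of weight and remains integral.  Its deviation
is a weighted sum of the others, with weights omega k / omega a <= 1, whence the
factor #|K| in the bound, and g a = 0 makes its sign condition hold. *)
Lemma signed_profile (R : archiRealFieldType) (K : finType) (omega : K -> nat) (a : K)
    (s0 : K -> nat) (c g : K -> R) :
  (0 < omega a)%N -> (forall k, omega k <= omega a)%N ->
  \sum_k (omega k)%:R * (s0 k)%:R = \sum_k (omega k)%:R * c k ->
  g a = 0 ->
  exists s : K -> int, [/\
    \sum_k (omega k)%:R * (s k)%:~R = \sum_k (omega k)%:R * c k,
    forall k, `|(s k)%:~R - c k| <= #|K|%:R * (omega a)%:R,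
    forall k, ((s k)%:~R - c k) * g k <= 0
    & forall k, g k != 0 -> ((s k)%:~R - c k) * g k < 0].
Proof.
move=> M_gt0 leM sum0 ga0; set M := omega a in M_gt0 leM *.
have MR_gt0 : 0 < M%:R :> R by rewrite ltr0n.
have [z zP] := fin_all_exists (fun k => signed_rounding R M ((s0 k)%:R - c k) (g k) M_gt0).
pose s k : int := if k == a then (s0 a)%:Z - \sum_(j | j != a) (omega j)%:Z * z j
                  else (s0 k)%:Z + M%:Z * z k.
have sE k : k != a -> (s k)%:~R - c k = (s0 k)%:R - c k + M%:R * (z k)%:~R.
  move=> /negPf ka; rewrite /s ka rmorphD rmorphM /= -!pmulrn; ring.
have saE : (s a)%:~R = (s0 a)%:R - \sum_(j | j != a) (omega j)%:R * (z j)%:~R :> R.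
  rewrite /s eqxx rmorphB rmorph_sum /= -pmulrn; congr (_ - _).
  by apply: eq_bigr => j _; rewrite rmorphM /= -pmulrn.
have sumE : \sum_k (omega k)%:R * (s k)%:~R = \sum_k (omega k)%:R * c k.
  rewrite -sum0 (bigD1 a) //= [RHS](bigD1 a) //= saE mulrBr -addrA; congr (_ + _).
  rewrite mulr_sumr addrC -sumrB; apply: eq_bigr => j /negPf ja.
  rewrite /s ja rmorphD rmorphM /= -!pmulrn -/M; ring.
have dev k : k != a -> `|(s k)%:~R - c k| <= M%:R.
  by move=> ka; rewrite sE //; case: (zP k).
exists s; split=> // k; have [->|ka] := eqVneq k a.
- have Mdev : M%:R * ((s a)%:~R - c a) = - \sum_(j | j != a) (omega j)%:R * ((s j)%:~R - c j).
    apply/eqP; rewrite -addr_eq0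
      -(bigD1 a (P := xpredT) (F := fun j => (omega j)%:R * ((s j)%:~R - c j))) //=.
    under eq_bigr do rewrite mulrBr.
    by rewrite sumrB sumE subrr.
  rewrite -(ler_pM2l MR_gt0) -[X in X * `|_|](gtr0_norm MR_gt0) -normrM Mdev normrN.
  apply: le_trans (ler_norm_sum _ _ _) _.
  have -> : M%:R * (#|K|%:R * M%:R) = \sum_(j : K) M%:R * M%:R :> R.
    by rewrite sumr_const -mulr_natl; ring.
  rewrite big_mkcond /=; apply: ler_sum => j _; case: ifP => [ja|_]; last by rewrite mulr_ge0.
  by rewrite normrM normr_nat ler_pM // ?dev // ler_nat.
- apply: le_trans (dev k ka) _; rewrite ler_peMl ?ler0n // ler1n.
  by apply/card_gt0P; exists a.
- by rewrite ga0 mulr0.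
- by rewrite sE //; case: (zP k).
- by rewrite ga0 eqxx.
- by rewrite sE //; case: (zP k).
Qed.

(** * A coalition of prescribed weight on which d is negative *)

(** The set K of types is abstract, with tau giving the type of a player and a
being a type of largest weight.  The two bounds on theta say that the
proportional profile stays strictly between 0 and the multiplicities when each
coordinate is moved by at most #|K| * omega a, the accuracy of
[signed_profile]. *)
Lemma improving_coalition (R : archiRealFieldType) (I K : finType) (tau : I -> K)
    (omega : K -> nat) (a : K) (S0 : {set I}) (theta : R) (d : I -> R) :
  (forall k, exists i, tau i = k) ->
  (0 < omega a)%N -> (forall k, omega k <= omega a)%N ->
  (\sum_(i in S0) omega (tau i))%:R = theta * (\sum_i omega (tau i))%:R ->
  (forall k, #|K|%:R * (omega a)%:R < theta * #|[set i | tau i == k]|%:R) ->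
  (forall k, #|K|%:R * (omega a)%:R < (1 - theta) * #|[set i | tau i == k]|%:R) ->
  \sum_i d i = 0 -> (exists i, d i != 0) ->
  exists T : {set I},
    (\sum_(i in T) omega (tau i) = \sum_(i in S0) omega (tau i))%N
    /\ \sum_(i in T) d i < 0.
Proof.
move=> tau_surj M_gt0 leM weight0 lower upper d_sum0 [i1 d_neq0].
have MR_gt0 : 0 < (omega a)%:R :> R by rewrite ltr0n.
pose C k := [set i | tau i == k]; pose m k : R := #|C k|%:R.
have m_gt0 k : 0 < m k.
  by have [i <-] := tau_surj k; rewrite ltr0n; apply/card_gt0P; exists i; rewrite inE.
pose delta k := (\sum_(i in C k) d i) / m k.
have mdelta k : m k * delta k = \sum_(i in C k) d i.
  by rewrite mulrC divfK // gt_eqF.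
have sum_types (h : I -> R) (F : K -> {set I}) : (forall k, F k \subset C k) ->
    \sum_(i | i \in F (tau i)) h i = \sum_k \sum_(i in F k) h i.
  move=> sF; rewrite (partition_big tau xpredT) //=; apply: eq_bigr => k _.
  apply: eq_bigl => i; apply/andP/idP => [[iF /eqP <-] //|iF].
  by have := subsetP (sF k) i iF; rewrite inE => /eqP ->.
have sum_const k (A : {set I}) : A \subset C k ->
    \sum_(i in A) (omega (tau i))%:R = (omega k)%:R * #|A|%:R :> R.
  move=> sA; rewrite mulrC mulr_natl -sumr_const; apply: eq_bigr => i iA.
  by have := subsetP sA i iA; rewrite inE => /eqP ->.
have sum_weights (F : K -> {set I}) : (forall k, F k \subset C k) ->
    \sum_(i | i \in F (tau i)) (omega (tau i))%:R = \sum_k (omega k)%:R * #|F k|%:R :> R.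
  by move=> sF; rewrite sum_types //; apply: eq_bigr => k _; rewrite (sum_const k).
have sum_all (h : I -> R) : \sum_i h i = \sum_k \sum_(i in C k) h i.
  by rewrite -sum_types //; apply: eq_bigl => i; rewrite inE eqxx.
have weight_all : \sum_i (omega (tau i))%:R = \sum_k (omega k)%:R * m k :> R.
  by rewrite -sum_weights //; apply: eq_bigl => i; rewrite inE eqxx.
pose s0 k := #|S0 :&: C k|.
have weight_S0 : \sum_k (omega k)%:R * (s0 k)%:R = (\sum_(i in S0) omega (tau i))%:R :> R.
  rewrite natr_sum -sum_weights => [|k]; last exact: subsetIr.
  by apply: eq_bigl => i; rewrite !inE eqxx andbT.
(* Subtracting a multiple of omega from delta changes the value of every profile
   of the same weight by the same amount; rho makes the result vanish at a. *)
pose rho := delta a / (omega a)%:R.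
pose gamma k := delta k - rho * (omega k)%:R.
have gamma_a : gamma a = 0 by rewrite /gamma /rho divfK ?subrr // gt_eqF.
have center : \sum_k (omega k)%:R * (s0 k)%:R = \sum_k (omega k)%:R * (theta * m k) :> R.
  rewrite weight_S0 weight0 natr_sum weight_all mulr_sumr.
  by apply: eq_bigr => k _; rewrite mulrCA.
have [s [s_weight s_near s_le0 s_lt0]] :=
  signed_profile _ _ _ _ _ _ _ M_gt0 leM center gamma_a.
have s_in k : (0 : R) < (s k)%:~R < m k.
  have := s_near k; rewrite ler_norml => /andP[lo hi].
  have := lower k; have := upper k; rewrite -/(C k) -/(m k) => ? ?.
  by apply/andP; split; lra.
have [r rE] : exists r : K -> nat, forall k, (s k)%:~R = (r k)%:R :> R.
  exists (fun k => `|s k|%N) => k.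
  have : 0 <= s k by rewrite -(ler0z R) ltW //; case/andP: (s_in k).
  by move=> /gez0_abs {1}<-.
have r_in k : (0 < r k < #|C k|)%N by have := s_in k; rewrite rE ltr0n ltr_nat.
have /fin_all_exists[F FP] k : exists T : {set I}, [/\ T \subset C k, #|T| = r k,
    m k * (\sum_(i in T) d i) <= (r k)%:R * \sum_(i in C k) d i
    & m k * (\sum_(i in T) d i) = (r k)%:R * \sum_(i in C k) d i ->
      {in C k &, forall i j, d i = d j}].
  have /andP[r_gt0 r_lt] := r_in k.
  have [T [sT cT leT eqT]] := low_subset R I (C k) d (r k) (ltnW r_lt).
  by exists T; split=> //; apply: eqT; rewrite r_gt0.
have sF k : F k \subset C k by case: (FP k).
exists [set i | i \in F (tau i)].
have inF i : (i \in [set i | i \in F (tau i)]) = (i \in F (tau i)) by rewrite inE.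
split.
  apply/eqP; rewrite -(eqr_nat R) -weight_S0 center -s_weight (eq_bigl _ _ inF).
  rewrite natr_sum sum_weights //; apply/eqP; apply: eq_bigr => k _.
  by case: (FP k) => _ -> _ _; rewrite rE.
rewrite (eq_bigl _ _ inF) sum_types //.
have le_F k : \sum_(i in F k) d i <= (r k)%:R * delta k.
  case: (FP k) => _ _ leF _; rewrite -(ler_pM2l (m_gt0 k)).
  by rewrite mulrCA mdelta.
have sum_delta : \sum_k m k * delta k = 0.
  by rewrite (eq_bigr _ (fun k _ => mdelta k)) -sum_all.
have sum_gamma : \sum_k (r k)%:R * delta k
    = \sum_k ((s k)%:~R - theta * m k) * gamma k.
  have -> : \sum_k ((s k)%:~R - theta * m k) * gamma k
    = \sum_k (r k)%:R * delta k - theta * (\sum_k m k * delta k)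
      - rho * (\sum_k (omega k)%:R * (s k)%:~R - \sum_k (omega k)%:R * (theta * m k)).
    rewrite -sumrB !mulr_sumr -!sumrB; apply: eq_bigr => k _.
    by rewrite rE /gamma; ring.
  by rewrite sum_delta s_weight; ring.
case: (boolP [exists k, gamma k != 0]) => [/existsP[k gk]|/existsPn gamma0].
  apply: le_lt_trans (ler_sum _ (fun k _ => le_F k)) _.
  rewrite sum_gamma (bigD1 k) //= -[X in _ < X]addr0.
  by rewrite ltr_leD ?s_lt0 // sumr_le0.
(* Now delta = rho * omega, and its sum over all players forces rho = 0. *)
have deltaE k : delta k = rho * (omega k)%:R.
  by apply/eqP; rewrite -subr_eq0; have := gamma0 k; rewrite negbK.
have rho0 : rho = 0.
  have : rho * (\sum_i (omega (tau i))%:R) == 0.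
    apply/eqP; rewrite weight_all mulr_sumr; apply: etrans sum_delta.
    by apply: eq_bigr => k _; rewrite deltaE mulrA [RHS]mulrC.
  rewrite mulf_eq0 => /orP[/eqP //|].
  have [i ia] := tau_surj a; rewrite (bigD1 i) //= ia gt_eqF //.
  by rewrite ltr_pwDl // sumr_ge0.
have delta0 k : delta k = 0 by rewrite deltaE rho0 mul0r.
have F_le0 k : \sum_(i in F k) d i <= 0 by have := le_F k; rewrite delta0 mulr0.
(* All averages vanish, so d is not constant on the type of i1, and the choice
   within that type is strictly below average. *)
rewrite (bigD1 (tau i1)) //= -[X in _ < X]addr0; apply: ltr_leD; last exact: sumr_le0.
rewrite lt_neqAle F_le0 andbT; apply/negP => /eqP F0; case/negP: d_neq0.
have C0 : \sum_(i in C (tau i1)) d i = 0 by rewrite -mdelta delta0 mulr0.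
have eq_d : {in C (tau i1) &, forall i j, d i = d j}.
  by case: (FP (tau i1)) => _ _ _; apply; rewrite F0 C0 !mulr0.
have i1C : i1 \in C (tau i1) by rewrite inE.
have : m (tau i1) * d i1 = 0.
  rewrite mulr_natl -sumr_const -[RHS]C0; apply: eq_bigr => i iC.
  exact: eq_d.
by move/eqP; rewrite mulf_eq0 gt_eqF.
Qed.

(** * The nucleolus of a large majority game *)

Lemma min_multiplicity_le (n : nat) (w : 'I_n.+1 -> nat) (i : 'I_n.+1) :
  (min_multiplicity w <= multiplicity w (w i))%N.
Proof.
rewrite /min_multiplicity; have : i \in index_enum 'I_n.+1 by rewrite mem_index_enum.
elim: (index_enum _) => // j s IHs; rewrite inE big_cons => /predU1P[<-|/IHs].
  exact: geq_minl.
by apply: leq_trans; exact: geq_minr.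
Qed.

Theorem proposition2 (R : realType) (n : nat) (w : 'I_n.+1 -> nat) (q : R) :
  (forall i j : 'I_n.+1, (i <= j)%N -> (w j <= w i)%N) ->
  (exists i, w i <> 0%N) ->
  0 <= q ->
  let qbar := q / (total_weight w)%:R in
  let wbar := (total_weight w)%:R^-1 *: weight_vector R w in
  Num.min qbar (1 - qbar) * (min_multiplicity w)%:R
    > 2 * (num_types w)%:R * (w ord0)%:R ^+ 2 ->
  is_nucleolus (weighted_majority_game q (weight_vector R w)) wbar.
Proof.
move=> w_sorted [i0 wi0] q_ge0 qbar wbar.
set M := w ord0; set W := total_weight w; set t := num_types w.
set mu := min_multiplicity w; set v := weighted_majority_game _ _.
move=> large.
have w_le i : (w i <= M)%N by exact: w_sorted.
have M_gt0 : (0 < M)%N by apply: leq_trans (w_le i0); rewrite lt0n; apply/eqP.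
have MR_ge1 : 1 <= M%:R :> R by rewrite ler1n.
have t_gt0 : (0 < t)%N.
  rewrite /t /num_types -has_predT; apply/hasP; exists (w ord0) => //.
  by rewrite mem_undup image_f.
have tR_ge1 : 1 <= t%:R :> R by rewrite ler1n.
have mu_M : (mu * M <= W)%N.
  apply: (@leq_trans (multiplicity w M * M)).
    by rewrite leq_mul2r min_multiplicity_le orbT.
  rewrite /W /total_weight (bigID (fun i => i \in [set j | w j == M])) /=.
  apply: leq_trans (leq_addr _ _); rewrite -sum_nat_const leq_eqVlt; apply/orP; left.
  by apply/eqP; apply: eq_bigr => i; rewrite inE => /eqP.
have W_gt0 : (0 < W)%N.
  rewrite /W /total_weight (bigD1 ord0) //=; exact: leq_trans M_gt0 (leq_addr _ _).
have WR_gt0 : 0 < W%:R :> R by rewrite ltr0n.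
have mu_le_W : mu%:R <= W%:R :> R.
  by rewrite ler_nat; apply: leq_trans mu_M; rewrite leq_pmulr.
have mu_ge0 : 0 <= mu%:R :> R by [].
have large_q : 2 * t%:R * M%:R ^+ 2 * W%:R < q * mu%:R.
  rewrite -ltr_pdivlMr // [ltRHS]mulrAC; apply: lt_le_trans large _.
  by rewrite ler_wpM2r // ge_min lexx.
have large_cq : 2 * t%:R * M%:R ^+ 2 * W%:R < (W%:R - q) * mu%:R.
  rewrite -ltr_pdivlMr // [ltRHS]mulrAC mulrBl divff ?gt_eqF //.
  by apply: lt_le_trans large _; rewrite ler_wpM2r // ge_min lexx orbT.
(* Since min_multiplicity w <= W, the two bounds also give M < q < W: no single
   player wins, and the grand coalition does. *)
have two_tM : M%:R < 2 * t%:R * M%:R ^+ 2 :> R by nra.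
have mu_gt0 : 0 < mu%:R :> R.
  rewrite lt0r mu_ge0 andbT; apply/eqP => mu0; move: large_q; rewrite mu0 mulr0.
  by apply/negP; rewrite -leNgt !mulr_ge0.
have M_lt_q : M%:R < q by nra.
have q_lt_W : q < W%:R by nra.
have weightE A : \sum_(i in A) weight_vector R w 0 i = (\sum_(i in A) w i)%:R.
  by rewrite natr_sum; apply: eq_bigr => i _; rewrite mxE.
have vE A : v A = if q <= (\sum_(i in A) w i)%:R then 1 else 0.
  by rewrite /v /weighted_majority_game weightE.
have payoffE A : payoff wbar A = (\sum_(i in A) w i)%:R / W%:R.
  rewrite /payoff -weightE mulr_suml; apply: eq_bigr => i _.
  by rewrite [LHS]mxE mulrC.
have sumT : (\sum_(i in [set: 'I_n.+1]) w i)%N = W.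
  by apply: eq_bigl => i; rewrite inE.
have vT : v [set: 'I_n.+1] = 1 by rewrite vE sumT ltW.
apply: is_nucleolus_of_max_excess.
  split=> [i|]; last by rewrite payoffE sumT vT divff ?gt_eqF.
  rewrite vE big_set1 [q <= _]leNgt (le_lt_trans _ M_lt_q) ?ler_nat //=.
  by rewrite mxE mulr_ge0 ?invr_ge0 // mxE.
move=> y [_ y_eff] y_neq.
pose winning (A : {set 'I_n.+1}) := q <= (\sum_(i in A) w i)%:R.
have Twin : winning [set: 'I_n.+1] by rewrite /winning sumT ltW.
case: (@arg_minnP _ _ winning (fun A : {set 'I_n.+1} => \sum_(i in A) w i)%N Twin).
move=> S0 S0win S0min.
rewrite /winning in S0win S0min.
set Q := (\sum_(i in S0) w i)%N in S0win S0min.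
(* A winning coalition of minimal weight loses as soon as a member of positive
   weight leaves it. *)
have Q_lt : Q%:R < q + M%:R.
  have [i iS wi_gt0] : exists2 i, i \in S0 & (0 < w i)%N.
    have : (Q != 0)%N.
      by rewrite -(eqr_nat R) gt_eqF // (lt_le_trans _ S0win) // (lt_trans _ M_lt_q) // ltr0n.
    rewrite sum_nat_eq0 negb_forall => /existsP[i].
    by rewrite negb_imply -lt0n => /andP[]; exists i.
  have QE : Q = (w i + \sum_(j in S0 :\ i) w j)%N by rewrite /Q (big_setD1 i).
  case: (leP q (\sum_(j in S0 :\ i) w j)%N%:R) => [/S0min|lose].
    by rewrite -/Q QE -{2}[(\sum_(j in _) _)%N]add0n leq_add2r leqNgt wi_gt0.
  by rewrite QE natrD addrC ltr_leD // ler_nat.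
pose ws := undup [seq w i | i : 'I_n.+1].
have w_in i : w i \in ws by rewrite mem_undup image_f.
pose tau i : seq_sub ws := SeqSub (w_in i).
have card_types : #|{: seq_sub ws}| = t by rewrite card_seq_sub ?undup_uniq.
have tau_surj (k : seq_sub ws) : exists i, tau i = k.
  have /imageP[i _ kE] : val k \in [seq w i | i : 'I_n.+1] by rewrite -mem_undup (valP k).
  by exists i; apply: val_inj.
have mu_le (k : seq_sub ws) : mu%:R <= #|[set i | tau i == k]|%:R :> R.
  have [i <-] := tau_surj k; rewrite ler_nat; apply: leq_trans (min_multiplicity_le _ w i) _.
  by rewrite /multiplicity; apply: eq_leq; apply: eq_card => j; rewrite !inE.
have M_mu : mu%:R * M%:R <= W%:R :> R by rewrite -natrM ler_nat.
have Q_le_W : Q%:R <= W%:R :> R by rewrite ler_nat -sumT S0min.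
pose d i := y 0 i - wbar 0 i.
have sum_d (A : {set 'I_n.+1}) : \sum_(i in A) d i = payoff y A - payoff wbar A by rewrite sumrB.
have [T [wT dT]] : exists T : {set 'I_n.+1},
    (\sum_(i in T) w i)%N = Q /\ \sum_(i in T) d i < 0.
  apply: (improving_coalition _ _ _ tau val (tau ord0) S0 (Q%:R / W%:R)) => //.
  - by move=> k; have [i <-] := tau_surj k; exact: w_le.
  - by rewrite -/Q divfK // gt_eqF.
  - move=> k; rewrite card_types; apply: lt_le_trans (_ : Q%:R / W%:R * mu%:R <= _); last first.
      by rewrite ler_wpM2l // divr_ge0.
    rewrite mulrAC ltr_pdivlMr //= -/M.
    have : q * mu%:R <= Q%:R * mu%:R by rewrite ler_wpM2r.
    apply: lt_le_trans; apply: le_lt_trans large_q.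
    by rewrite ler_pM2r //; nra.
  - move=> k; rewrite card_types; apply: lt_le_trans (_ : (1 - Q%:R / W%:R) * mu%:R <= _); last first.
      by rewrite ler_wpM2l // subr_ge0 ler_pdivrMr // mul1r.
    have -> : (1 - Q%:R / W%:R) * mu%:R = (W%:R - Q%:R) * mu%:R / W%:R :> R.
      by rewrite [RHS]mulrAC [(W%:R - _) / _]mulrBl divff ?gt_eqF.
    rewrite ltr_pdivlMr //= -/M.
    (* Replacing q by Q < q + M costs at most M * mu <= W, which the factor 2 in
       the hypothesis absorbs. *)
    have tM : t%:R * M%:R + 1 <= 2 * t%:R * M%:R ^+ 2 :> R by nra.
    nra.
  - have <- : \sum_(i in [set: 'I_n.+1]) d i = \sum_i d i by apply: eq_bigl => i; rewrite inE.
    by rewrite sum_d y_eff payoffE sumT vT divff ?subrr // gt_eqF.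
  - apply/existsP; apply: contraR y_neq; rewrite negb_exists => /forallP d0.
    apply/eqP/rowP => i; apply/eqP; rewrite -subr_eq0.
    by have := d0 i; rewrite negbK.
exists T => A; rewrite /excess.
apply: (@le_lt_trans _ _ (1 - Q%:R / W%:R)); last first.
  have -> : v T = 1 by rewrite vE wT S0win.
  by move: dT; rewrite sum_d payoffE wT subr_lt0 ltrD2l ltrN2.
rewrite payoffE vE; case: ifP => [Awin|_].
  by rewrite lerD2l lerN2 ler_pM2r ?invr_gt0 // ler_nat S0min.
apply: (@le_trans _ _ 0); first by rewrite sub0r oppr_le0 divr_ge0.
by rewrite subr_ge0 ler_pdivrMr // mul1r.
Qed.
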